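(* Let $A$ be a basic Brauer tree algebra with multiplicity one over an algebraically closed field $K$. Let $P_i$, $P_j$ be stalk complexes of indecomposable projective $A$-modules and let $P_i\oplus P_j$ be a partial tilting complex. Then $\mathrm{Hom}_{K^b(A)}(P_i,P_j)\neq 0$ if and only if $P_i$ and $P_j$ are concentrated in the same degree and the vertices corresponding to $P_i$ and $P_j$ belong to the same $A$-cycle.
   Context: Modules are finitely generated left modules; in a path algebra $ab$ means first $a$, then $b$. $K^b(A)$ is the bounded homotopy category of $A$-modules. Let $\Gamma$ be a finite tree with $n$ edges and a fixed cyclic ordering of the edges incident to each vertex. The Brauer quiver $Q_\Gamma$ has the edges of $\Gamma$ as vertices; for each vertex $v$ of $\Gamma$ and each edge $i$ incident to $v$ there is an arrow $i\to j$, where $j$ follows $i$ in the cyclic order at $v$ (a loop if $i$ is the only edge at $v$). So $Q_\Gamma$ is the union of oriented cycles, one for each vertex of $\Gamma$, and every vertex of $Q_\Gamma$ lies on exactly two of them. The arrows are divided into two families $\alpha$ and $\beta$ so that arrows of intersecting cycles are in different families. The basic Brauer tree algebra with multiplicity one of $\Gamma$ is $A=KQ_\Gamma/I$, with $I$ generated by $\alpha\beta=0=\beta\alpha$ and, for each vertex $x$, $\alpha^{x_\alpha}=\beta^{x_\beta}$, where $x_\alpha$ (resp. $x_\beta$) is the length of the $\alpha$-cycle (resp. $\beta$-cycle) through $x$. An $A$-cycle is a maximal ordered set of nonrepeating arrows such that the product of any two neighboring ones is nonzero; the $A$-cycles are the oriented cycles attached to the vertices of $\Gamma$ (including formal loops),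 so every vertex of the quiver lies on exactly two $A$-cycles. For a vertex $x$, $Ae_x$ is the corresponding indecomposable projective; $x$ is called the vertex corresponding to $Ae_x$. The stalk complexes considered are concentrated in degree $0$ or $1$. A perfect complex $T$ (bounded, of finitely generated projectives) is partial tilting if $\mathrm{Hom}_{D^b(A)}(T,T[i])=0$ for all $i\ne0$. *)

(* Defs.v *)
From HB Require Import structures.
From mathcomp Require Import all_boot all_order all_algebra.
From mathcomp Require Import generic_quotient ring_quotient.
From mathcomp Require Import boolp classical_sets functions.

Set Implicit Arguments.
Unset Strict Implicit.
Unset Printing Implicit Defensive.

Import GRing.Theory.
Local Open Scope ring_scope.
Local Open Scope quotient_scope.

Record quiver := Quiver {
  qvert : finType;
  qarr : finType;
  qsrc : qarr -> qvert;
  qtgt : qarr -> qvert }.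

Section PathAlgebra.
Variables (K : fieldType) (Q : quiver).

(** A path is coded by its source and its sequence of arrows, in the order of
    travel; [(x, [::])] is the trivial path at [x]. *)
Definition prepath := (qvert Q * seq (qarr Q))%type.

Fixpoint is_walk (x : qvert Q) (s : seq (qarr Q)) : bool :=
  if s is a :: s' then (qsrc a == x) && is_walk (qtgt a) s' else true.

Definition is_path (p : prepath) : bool := is_walk p.1 p.2.

Definition walk_end (x : qvert Q) (s : seq (qarr Q)) : qvert Q :=
  last x (map (@qtgt Q) s).

Lemma is_walk_cat x s t :
  is_walk x (s ++ t) = is_walk x s && is_walk (walk_end x s) t.
Proof. by elim: s x => //= a s IH x; rewrite IH andbA. Qed.

Definition path_supported (f : prepath -> K^o) : Prop :=
  (forall p, f p != 0 -> is_path p) /\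
  (exists s : seq prepath, forall p, f p != 0 -> p \in s).

Definition path_supp : {pred (prepath -> K^o)} := fun f => `[< path_supported f >].

Lemma path_supp_submod : submod_closed path_supp.
Proof.
split=> [|c f g /asboolP[pf [sf hf]] /asboolP[pg [sg hg]]]; apply/asboolP.
  by split=> [p|]; [|exists [::] => p]; rewrite eqxx.
have nz p : (c *: f + g) p != 0 -> (f p != 0) || (g p != 0).
  apply: contraNT; rewrite negb_or !negbK => /andP[/eqP f0 /eqP g0].
  by rewrite !fctE f0 g0 scaler0 addr0.
split=> [p /nz/orP[/pf|/pg] //|].
by exists (sf ++ sg) => p /nz/orP[/hf|/hg]; rewrite mem_cat => ->; rewrite ?orbT.
Qed.
HB.instance Definition _ :=
  GRing.isSubmodClosed.Build K (prepath -> K^o) path_supp path_supp_submod.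

(** Finitely supported [K]-valued functions on the set of paths. *)
Record path_algebra := PathAlgebra {
  pcoef :> prepath -> K^o;
  pcoefP : pcoef \in path_supp }.

HB.instance Definition _ := [isSub for pcoef].
HB.instance Definition _ := [Choice of path_algebra by <:].
HB.instance Definition _ := [SubChoice_isSubLmodule of path_algebra by <:].

Lemma path_algebraP (f g : path_algebra) : (forall x s, f (x, s) = g (x, s)) -> f = g.
Proof. by move=> fg; apply/val_inj/funext => -[x s]; apply: fg. Qed.

(** The product is the bilinear extension of concatenation: [p * q] is the path
    first [p], then [q], and is zero if [p] does not end where [q] starts. *)
Definition pmul_fun (f g : prepath -> K^o) (p : prepath) : K :=
  \sum_(i < (size p.2).+1)
     f (p.1, take i p.2) * g (walk_end p.1 (take i p.2), drop i p.2).

Definition pone_fun (p : prepath) : K := (p.2 == [::])%:R.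

Definition pelt_fun (p0 p : prepath) : K := (is_path p && (p == p0))%:R.

Lemma pmul_supp (f g : path_algebra) : pmul_fun f g \in path_supp.
Proof.
have /asboolP[pf [sf hf]] := pcoefP f; have /asboolP[pg [sg hg]] := pcoefP g.
have nz p : pmul_fun f g p != 0 -> exists i : 'I_(size p.2).+1,
    f (p.1, take i p.2) != 0 /\ g (walk_end p.1 (take i p.2), drop i p.2) != 0.
  apply: contra_neqP => /forallNP no; apply: big1 => i _; apply/eqP.
  by rewrite mulf_eq0; apply/norP => -[fi gi]; apply: (no i).
apply/asboolP; split=> [[x s] /nz[i [/pf fi /pg gi]]|].
  by rewrite /is_path /= -(cat_take_drop i s) is_walk_cat; apply/andP.
exists [seq (p.1, p.2 ++ q.2) | p <- sf, q <- sg] => -[x s] /nz[i /= [/hf fi /hg gi]].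
by apply/allpairsP; eexists (_, _); split; [exact: fi|exact: gi|rewrite /= cat_take_drop].
Qed.

Lemma pone_supp : pone_fun \in path_supp.
Proof.
have nz p : pone_fun p != 0 -> p.2 = [::].
  by rewrite /pone_fun; case: (p.2 =P [::]) => // _; rewrite eqxx.
apply/asboolP; split=> [[x s] /nz /= -> //|].
exists [seq (x, [::]) | x <- enum (qvert Q)] => -[x s] /nz /= ->.
by apply/mapP; exists x; rewrite ?mem_enum.
Qed.

Lemma pelt_supp p0 : pelt_fun p0 \in path_supp.
Proof.
have nz p : pelt_fun p0 p != 0 -> is_path p && (p == p0).
  by rewrite /pelt_fun; case: (_ && _) => //; rewrite eqxx.
apply/asboolP; split=> [p /nz/andP[] //|].
by exists [:: p0] => p /nz/andP[_ /eqP->]; rewrite inE.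
Qed.

Definition pmul (f g : path_algebra) := PathAlgebra (pmul_supp f g).
Definition pone := PathAlgebra pone_supp.

Lemma walk_end_cat x s t : walk_end x (s ++ t) = walk_end (walk_end x s) t.
Proof. by rewrite /walk_end map_cat last_cat. Qed.

Lemma pmulA : associative pmul.
Proof.
move=> f g h; apply: path_algebraP => x s; rewrite /= /pmul_fun /=.
pose F i j := f (x, take i s) *
  (g (walk_end x (take i s), take j (drop i s)) *
   h (walk_end x (take (i + j) s), drop (i + j) s)).
transitivity (\sum_(0 <= i < (size s).+1) \sum_(0 <= j < (size s - i).+1) F i j).
  rewrite big_mkord; apply: eq_bigr => i _.
  rewrite big_distrr big_mkord /= size_drop; apply: eq_bigr => j _.
  by rewrite /F -walk_end_cat -takeD drop_drop [(j + i)%N]addnC.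
transitivity (\sum_(0 <= k < (size s).+1) \sum_(0 <= i < k.+1) F i (k - i)%N);
  last first.
  rewrite big_mkord; apply: eq_bigr => k _.
  have ks : (k <= size s)%N by rewrite -ltnS.
  rewrite big_distrl big_mkord /= size_takel //; apply: eq_bigr => i _.
  have ik : (i <= k)%N by rewrite -ltnS.
  by rewrite /F subnKC // mulrA take_takel // take_drop subnK.
rewrite !big_mkord.
under eq_bigr do rewrite big_mkord.
under [RHS]eq_bigr do rewrite big_mkord.
have widen n (G : nat -> K) m : (m <= n)%N ->
    \sum_(i < m) G i = \sum_(i < n | (i < m)%N) G i.
  by move=> mn; rewrite (big_ord_widen _ G mn).
transitivity (\sum_(i < (size s).+1) \sum_(k < (size s).+1 | (i <= k)%N) F i (k - i)%N).
  apply: eq_bigr => -[i /= i_lt] _.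
  rewrite -(big_mkord xpredT (F i)).
  rewrite -(big_mkord (fun k => (i <= k)%N) (fun k => F i (k - i)%N)).
  rewrite (@big_cat_nat _ _ _ i 0 (size s).+1) ?(ltnW i_lt) //=.
  rewrite [X in _ = X + _]big1_seq ?add0r; last first.
    by move=> k /andP[ik]; rewrite mem_index_iota /= ltnNge ik.
  have := big_addn 0 (size s).+1 i (fun k => (i <= k)%N) (fun k => F i (k - i)%N).
  rewrite add0n => -> /=; rewrite subSn //.
  by apply: congr_big_nat => // k _; rewrite ?leq_addl ?addnK.
rewrite (exchange_big_dep xpredT) //=; apply: eq_bigr => k _.
by rewrite (widen (size s).+1 (fun i => F i (k - i)%N)) // ltnS; apply: eq_bigl.
Qed.

Lemma pmul1f : left_id pone pmul.
Proof.
move=> f; apply: path_algebraP => x s; rewrite /= /pmul_fun /= big_ord_recl /=.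
rewrite big1 ?addr0 => [|i _]; first by rewrite take0 drop0 /pone_fun eqxx mul1r.
rewrite /pone_fun /=; case: s i => [[]//|a s i].
by rewrite /= mul0r.
Qed.

Lemma pmulf1 : right_id pone pmul.
Proof.
move=> f; apply: path_algebraP => x s; rewrite /= /pmul_fun /= big_ord_recr /=.
rewrite big1 ?add0r => [|i _]; first by rewrite take_size drop_size /pone_fun eqxx mulr1.
by rewrite /pone_fun -size_eq0 /= size_drop subn_eq0 leqNgt ltn_ord mulr0.
Qed.

Lemma pcoefD (f g : path_algebra) p : (f + g) p = f p + g p.
Proof. by []. Qed.

Lemma pcoefZ (c : K) (f : path_algebra) p : (c *: f) p = c * f p.
Proof. by []. Qed.

Lemma pmulDl : left_distributive pmul +%R.
Proof.
move=> f g h; apply: path_algebraP => x s; rewrite pcoefD /= /pmul_fun -big_split /=.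
by apply: eq_bigr => i _; apply: mulrDl.
Qed.

Lemma pmulDr : right_distributive pmul +%R.
Proof.
move=> f g h; apply: path_algebraP => x s; rewrite pcoefD /= /pmul_fun -big_split /=.
by apply: eq_bigr => i _; apply: mulrDr.
Qed.

HB.instance Definition _ :=
  GRing.Zmodule_isPzRing.Build path_algebra pmulA pmul1f pmulf1 pmulDl pmulDr.

Lemma pscaleAl (c : K) (f g : path_algebra) : c *: (f * g) = (c *: f) * g.
Proof.
apply: path_algebraP => x s; rewrite pcoefZ /= /pmul_fun mulr_sumr.
by apply: eq_bigr => i _; apply: mulrA.
Qed.

Lemma pscaleAr (c : K) (f g : path_algebra) : c *: (f * g) = f * (c *: g).
Proof.
apply: path_algebraP => x s; rewrite pcoefZ /= /pmul_fun mulr_sumr.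
by apply: eq_bigr => i _; apply: mulrCA.
Qed.

(** [pelt p] is zero when [p] is not a path. *)
Definition pelt (p : prepath) : path_algebra := PathAlgebra (pelt_supp p).
Definition pidem (x : qvert Q) : path_algebra := pelt (x, [::]).
Definition parrow (a : qarr Q) : path_algebra := pelt (qsrc a, [:: a]).

End PathAlgebra.

Section QuotientRing.
Variables (R : pzRingType) (S : R -> Prop).

Inductive in_ideal : R -> Prop :=
| in_ideal_gen r of S r : in_ideal r
| in_ideal0 : in_ideal 0
| in_idealD r s of in_ideal r & in_ideal s : in_ideal (r + s)
| in_idealMl a r of in_ideal r : in_ideal (a * r)
| in_idealMr a r of in_ideal r : in_ideal (r * a).

Definition ideal : {pred R} := fun r => `[< in_ideal r >].

Lemma ideal_zmod : zmod_closed ideal.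
Proof.
split=> [|x y /asboolP xI /asboolP yI]; apply/asboolP; first exact: in_ideal0.
by apply: in_idealD => //; rewrite -mulN1r; apply: in_idealMl.
Qed.
HB.instance Definition _ := GRing.isZmodClosed.Build R ideal ideal_zmod.

Definition quot_ring := Quotient.quot ideal.
HB.instance Definition _ := EqQuotient.on quot_ring.
HB.instance Definition _ := GRing.Zmodule.on quot_ring.

Definition qproj (r : R) : quot_ring := \pi_quot_ring r.

Definition qone : quot_ring := qproj 1.
Definition qmul (u v : quot_ring) : quot_ring := qproj (repr u * repr v).

Lemma qprojP r s : qproj r = qproj s <-> in_ideal (r - s).
Proof.
split=> [/eqP|rs]; last apply/eqP.
  by rewrite -Quotient.idealrBE => /asboolP.
by rewrite -Quotient.idealrBE; apply/asboolP.
Qed.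

Lemma qprojK u : qproj (repr u) = u. Proof. exact: reprK. Qed.

Lemma qprojM r s : qproj (r * s) = qmul (qproj r) (qproj s).
Proof.
have /qprojP rI := qprojK (qproj r); have /qprojP sI := qprojK (qproj s).
apply/esym/qprojP; set r' := repr _ in rI *; set s' := repr _ in sI *.
rewrite -(subrKA (r' * s)) -mulrBr -mulrBl.
by apply: in_idealD; [apply: in_idealMl | apply: in_idealMr].
Qed.

Lemma qprojD r s : qproj (r + s) = qproj r + qproj s.
Proof. by rewrite /qproj !piE. Qed.

Lemma qmulA : associative qmul.
Proof.
move=> u v w; rewrite -(qprojK u) -(qprojK v) -(qprojK w).
by rewrite -!qprojM mulrA.
Qed.
Lemma qmul1r : left_id qone qmul.
Proof. by move=> u; rewrite -(qprojK u) -qprojM mul1r. Qed.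
Lemma qmulr1 : right_id qone qmul.
Proof. by move=> u; rewrite -(qprojK u) -qprojM mulr1. Qed.
Lemma qmulDl : left_distributive qmul +%R.
Proof.
move=> u v w; rewrite -(qprojK u) -(qprojK v) -(qprojK w).
by rewrite -qprojD -!qprojM -qprojD mulrDl.
Qed.
Lemma qmulDr : right_distributive qmul +%R.
Proof.
move=> u v w; rewrite -(qprojK u) -(qprojK v) -(qprojK w).
by rewrite -qprojD -!qprojM -qprojD mulrDr.
Qed.
HB.instance Definition _ :=
  GRing.Zmodule_isPzRing.Build quot_ring qmulA qmul1r qmulr1 qmulDl qmulDr.

End QuotientRing.

Section Modules.
Variable R : pzRingType.
Implicit Types M N P : lmodType R.

Definition zero_module M : Prop := forall x : M, x = 0.

Definition module_iso M N : Prop := exists f : {linear M -> N}, bijective f.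

Definition fin_gen M : Prop :=
  exists (n : nat) (g : 'I_n -> M),
    forall x : M, exists c : 'I_n -> R, x = \sum_(i < n) c i *: g i.

Definition projective P : Prop :=
  forall (M N : lmodType R) (g : {linear M -> N}) (f : {linear P -> N}),
    (forall y, exists x, g x = y) ->
    exists h : {linear P -> M}, forall x, g (h x) = f x.

Definition indecomposable M : Prop :=
  ~ zero_module M /\
  forall N1 N2 : lmodType R,
    module_iso M (N1 * N2)%type -> zero_module N1 \/ zero_module N2.

Section LeftIdeal.
Variable e : R.

Definition principal_left : {pred R^o} := fun y => `[< exists b : R, y = b * e >].

Lemma principal_left_submod : submod_closed principal_left.
Proof.
split=> [|c _ _ /asboolP[b ->] /asboolP[b' ->]]; apply/asboolP.
  by exists 0; rewrite mul0r.
by exists (c * b + b'); rewrite mulrDl -mulrA.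
Qed.
HB.instance Definition _ :=
  GRing.isSubmodClosed.Build R R^o principal_left principal_left_submod.

Record left_ideal := LeftIdeal {
  left_ideal_val :> R^o;
  left_idealP : left_ideal_val \in principal_left }.

HB.instance Definition _ := [isSub for left_ideal_val].
HB.instance Definition _ := [Choice of left_ideal by <:].
HB.instance Definition _ := [SubChoice_isSubLmodule of left_ideal by <:].

End LeftIdeal.
End Modules.

Section Complexes.
Variable R : pzRingType.

(** The differential has a component for every pair of degrees, and the
    components other than [i -> i + 1] vanish; this avoids transports along
    equalities of degrees, in particular for shifts. *)
Record complex := Complex {
  cobj :> int -> lmodType R;
  cdiff : forall i j, {linear cobj i -> cobj j};
  cdiff_shape : forall i j x, j != i + 1 -> cdiff i j x = 0;
  cdiffK : forall i j k x, cdiff j k (cdiff i j x) = 0 }.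

Record chain_map (X Y : complex) := ChainMap {
  cmap :> forall i, {linear X i -> Y i};
  cmapC : forall i j x, cmap j (cdiff X i j x) = cdiff Y i j (cmap i x) }.

Definition cmap0 (X Y : complex) : chain_map X Y.
Proof.
exists (fun i => \0 : {linear X i -> Y i}) => i j x.
by rewrite linear0.
Defined.

Definition cmap_comp (X Y Z : complex) (g : chain_map Y Z) (f : chain_map X Y) :
  chain_map X Z.
Proof.
exists (fun i => g i \o f i : {linear X i -> Z i}) => i j x.
by rewrite /= !cmapC.
Defined.

Definition homotopic (X Y : complex) (f g : chain_map X Y) : Prop :=
  exists h : forall i j, {linear X i -> Y j}, forall i (x : X i),
    f i x - g i x = cdiff Y (i - 1) i (h i (i - 1) x)
                    + h (i + 1) i (cdiff X i (i + 1) x).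

(** A morphism of the homotopy category is a chain map up to homotopy. *)
Definition HomK_neq0 (X Y : complex) : Prop :=
  exists f : chain_map X Y, ~ homotopic f (cmap0 X Y).

Definition bounded (X : complex) : Prop :=
  exists n : nat, forall i : int, (n < `|i|)%N -> zero_module (X i).

Definition Db_object (X : complex) : Prop :=
  bounded X /\ forall i, fin_gen (X i).

Definition quasi_iso (X Y : complex) (f : chain_map X Y) : Prop :=
  (* injectivity and surjectivity on cohomology in every degree *)
  (forall i (x : X i), cdiff X i (i + 1) x = 0 ->
     (exists y, f i x = cdiff Y (i - 1) i y) ->
     exists w, x = cdiff X (i - 1) i w) /\
  (forall i (y : Y i), cdiff Y i (i + 1) y = 0 ->
     exists x w, cdiff X i (i + 1) x = 0 /\ y = f i x + cdiff Y (i - 1) i w).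

(** Morphisms [X -> Y] of the derived category are roofs [X <- Z -> Y], the left
    leg being a quasi-isomorphism, up to [roof_eq]. *)
Record roof (X Y : complex) := Roof {
  apex : complex;
  apexP : Db_object apex;
  roof_l : chain_map apex X;
  roof_r : chain_map apex Y;
  roof_lP : quasi_iso roof_l }.

Definition roof_eq (X Y : complex) (r s : roof X Y) : Prop :=
  exists (W : complex) (u : chain_map W (apex r)) (v : chain_map W (apex s)),
    [/\ Db_object W,
        quasi_iso (cmap_comp (roof_l r) u),
        homotopic (cmap_comp (roof_l r) u) (cmap_comp (roof_l s) v) &
        homotopic (cmap_comp (roof_r r) u) (cmap_comp (roof_r s) v)].

(** A Hom group vanishes when any two of its elements agree. *)
Definition HomD_eq0 (X Y : complex) : Prop := forall r s : roof X Y, roof_eq r s.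

(** [X[k]], with [X[k]^i = X^(i+k)] and differential [(-1)^k d]. *)
Definition shift_diff (k : int) (X : complex) (i j : int) :
    {linear X (i + k) -> X (j + k)} :=
  if odd `|k|%N then (\- cdiff X (i + k) (j + k)) : {linear _ -> _}
  else cdiff X (i + k) (j + k).

Definition shift (k : int) (X : complex) : complex.
Proof.
exists (fun i => X (i + k)) (shift_diff k X) => [i j x ij|i j l x].
  have d0 : cdiff X (i + k) (j + k) x = 0.
    apply: cdiff_shape; apply: contra ij => /eqP.
    by rewrite addrAC => /addIr ->.
  by rewrite /shift_diff; case: ifP => _ //=; rewrite d0 oppr0.
rewrite /shift_diff; case: ifP => _ /=; last exact: cdiffK.
by rewrite linearN cdiffK !oppr0.
Defined.

Definition dsum_diff (X Y : complex) (i j : int) (z : (X i * Y i)%type) :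
    (X j * Y j)%type :=
  (cdiff X i j z.1, cdiff Y i j z.2).

Lemma dsum_diff_linear (X Y : complex) i j : linear (@dsum_diff X Y i j).
Proof. by move=> c [x y] [x' y']; rewrite /dsum_diff /= !linearP. Qed.
HB.instance Definition _ (X Y : complex) i j :=
  GRing.isLinear.Build R (X i * Y i)%type (X j * Y j)%type _
    (@dsum_diff X Y i j) (@dsum_diff_linear X Y i j).

Definition dsum (X Y : complex) : complex.
Proof.
exists (fun i => (X i * Y i)%type) (fun i j => @dsum_diff X Y i j)
    => [i j x ij|i j k x]; rewrite /= /dsum_diff.
  by rewrite !cdiff_shape.
by rewrite /= !cdiffK.
Defined.

(** [M] in cohomological degree [n], and zero elsewhere. *)
Definition stalk (n : int) (M : lmodType R) : complex.
Proof.
by exists (fun i => if i == n then M else 'rV[R]_0) (fun i j => \0).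
Defined.

Definition perfect (T : complex) : Prop :=
  bounded T /\ forall i, fin_gen (T i) /\ projective (T i).

Definition partial_tilting (T : complex) : Prop :=
  perfect T /\ forall k : int, k != 0 -> HomD_eq0 T (shift k T).

End Complexes.

Record tree := Tree {
  tvert : finType;
  tedge : finType;
  ends : tedge -> {set tvert};
  ends_card : forall i, #|ends i| = 2%N;
  ends_inj : injective ends;
  tadj : rel tvert := fun u v => [exists i, ends i == [set u; v]];
  tree_nonempty : (0 < #|tvert|)%N;
  tree_connected : forall u v, connect tadj u v;
  tree_acyclic : forall c : seq tvert, ucycle tadj c -> (size c <= 2)%N }.

(** [(v, i)] with [i] an edge at [v]. *)
Definition half_edge (G : tree) : finType :=
  {p : tvert G * tedge G | p.1 \in ends p.2}.

Definition hvert (G : tree) (a : half_edge G) : tvert G := (val a).1.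
Definition hedge (G : tree) (a : half_edge G) : tedge G := (val a).2.

(** [next (v, i) = (v, j)] where [j] follows [i] in the cyclic ordering at [v]:
    the [next]-orbit of a half-edge at [v] consists of all half-edges at [v]. *)
Record brauer_tree := BrauerTree {
  btree :> tree;
  next_at : half_edge btree -> half_edge btree;
  next_atP : forall a b, fconnect next_at a b = (hvert a == hvert b) }.

Section BrauerTreeAlgebra.
Variables (K : fieldType) (G : brauer_tree).

(** The half-edge [(v, i)] is the arrow [i -> j] of the oriented cycle of [v]. *)
Definition brauer_quiver : quiver :=
  @Quiver (tedge G) (half_edge G) (@hedge G) (fun a => hedge (next_at a)).

Local Notation arrow := (half_edge G).
Local Notation KQ := (path_algebra K brauer_quiver).

(** The oriented cycles of the quiver attached to [u] and [v] share a vertex. *)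
Definition cycles_meet (u v : tvert G) : Prop :=
  exists a b : arrow, [/\ hvert a = u, hvert b = v & hedge a = hedge b].

(** [true] is the family alpha, [false] is the family beta. *)
Definition two_families (fam : arrow -> bool) : Prop :=
  forall a b : arrow, hvert a <> hvert b -> cycles_meet (hvert a) (hvert b) ->
    fam a != fam b.

Definition arr (a : arrow) : KQ := @parrow K brauer_quiver a.

(** The power of alpha (or beta) which runs once around the oriented cycle
    through [a], starting with [a]. *)
Definition cycle_power (a : arrow) : KQ := \prod_(b <- orbit (@next_at G) a) arr b.

Inductive brauer_relation (fam : arrow -> bool) : KQ -> Prop :=
| rel_mixed a b of fam a != fam b : brauer_relation fam (arr a * arr b)
| rel_cycles a b of hedge a = hedge b & fam a & ~~ fam b :
    brauer_relation fam (cycle_power a - cycle_power b).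

(** Only the ring structure of [K Q / I] is recorded: [K] acts through the
    central elements [c *: 1], so ring modules are the modules over the
    [K]-algebra, and module morphisms are [K]-linear. *)
Definition brauer_algebra (fam : arrow -> bool) : pzRingType :=
  quot_ring (brauer_relation fam).

Variable fam : arrow -> bool.
Local Notation A := (brauer_algebra fam).

Definition idem (x : tedge G) : A := qproj _ (@pidem K brauer_quiver x).

Definition arrA (a : arrow) : A := qproj _ (arr a).

Definition proj_at (x : tedge G) : lmodType A := left_ideal (idem x).

(** Neighbors are consecutive entries only: the last arrow is not compared with
    the first one, so that a loop [a], with [a * a = 0], forms an A-cycle. *)
Definition A_chain (s : seq arrow) : Prop :=
  uniq s /\ sorted (fun a b => arrA a * arrA b != 0) s.

Definition A_cycle (s : seq arrow) : Prop :=
  A_chain s /\ forall t, A_chain t -> infix s t -> t = s.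

Definition lies_on (x : tedge G) (s : seq arrow) : Prop :=
  exists2 a, a \in s & x = hedge a \/ x = hedge (next_at a).

End BrauerTreeAlgebra.

(* Main.v *)
From HB Require Import structures.
Require Import Defs.
From mathcomp Require Import all_boot all_order all_algebra.
From mathcomp Require Import boolp.

(** A chain map between the stalk complexes of [M] in degree [a] and [N] in
    degree [b] is a linear map [M -> N] if [a = b] and zero otherwise, and
    homotopies vanish. Since [Hom (A e_x, A e_y)] is [e_x A e_y]
    ([nonzero_map_iso]), it remains to see that [e_x A e_y] is nonzero exactly
    when the edges [x] and [y] of the tree have a common vertex ([corner_neq0]),
    and that this amounts to lying on a common A-cycle ([common_A_cycle]).

    The families alpha and beta are constant around each vertex of the tree and
    differ at the two ends of an edge. Two composable arrows that are not
    consecutive around one vertex therefore multiply to zero by a mixed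
    relation, so a nonzero path turns around a single vertex of the tree, and
    its source and target are edges at that vertex ([corner_ideal]).

    The other direction needs that a path of at most one full turn around a
    vertex is nonzero in the algebra. The proof uses the linear form on [K Q]
    that sums the coefficients of all full turns ([trace_form]). A full turn has
    no mixed pair of neighbors, and it has no full turn as a proper subword;
    hence the form vanishes on the ideal of relations ([trace_form_ideal]). It
    takes the value 1 on a full turn, and every arc divides a full turn
    ([arc_neq0]).

    In the algebra, the product of the arrows [a] and [b] can thus be nonzero
    only if [b] follows [a] around a vertex, and it is nonzero then unless [a]
    is a loop. So the chains are the arcs without repetition, and the full turn
    from any given arrow is maximal among them ([orbit_A_cycle]). *)

Set Implicit Arguments.
Unset Strict Implicit.
Unset Printing Implicit Defensive.

Import GRing.Theory.
Local Open Scope ring_scope.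

(** * Products of paths *)

Local Arguments pcoef : simpl never.

Section Paths.
Variables (K : fieldType) (Q : quiver).
Local Notation KQ := (path_algebra K Q).
Implicit Types (x y z : qvert Q) (s t u : seq (qarr Q)) (f g h : KQ).

Lemma coef_pmul f g x s :
  (f * g) (x, s) =
  \sum_(i < (size s).+1) f (x, take i s) * g (walk_end x (take i s), drop i s).
Proof. by []. Qed.

Lemma coef_pelt x s y t :
  pelt K (x, s) (y, t) = (is_walk y t && ((y, t) == (x, s)))%:R.
Proof. by []. Qed.

Lemma coef_pelt_mul x s f y t :
  (pelt K (x, s) * f) (y, t) =
  if [&& y == x, is_walk x s & prefix s t]
  then f (walk_end x s, drop (size s) t) else 0.
Proof.
have term0 i : ~~ [&& y == x, is_walk x s & take i t == s] ->
    pelt K (x, s) (y, take i t) * f (walk_end y (take i t), drop i t) = 0.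
  move=> no; rewrite coef_pelt xpair_eqE; case: eqVneq no => [->|_ _] /=; last first.
    by rewrite andbF mul0r.
  by case: eqVneq => [->|_ _]; rewrite ?andbF ?mul0r // !andbT => /negPf->;
    rewrite mul0r.
(* The prefix of [t] that equals [s] is cut off at [i = size s]. *)
rewrite coef_pmul; case: ifP => [/and3P[/eqP yx s_walk /prefixP[u us]]|no].
  rewrite {}yx {}us in term0 *.
  have s_lt : (size s < (size (s ++ u)).+1)%N by rewrite ltnS size_cat leq_addr.
  rewrite (bigD1 (Ordinal s_lt)) //= take_size_cat // drop_size_cat // big1 ?addr0.
    by rewrite coef_pelt s_walk eqxx mul1r.
  move=> i i_s; rewrite {}term0 //; apply: contra i_s => /and3P[_ _ /eqP s_i].
  rewrite -val_eqE /= -[in X in _ == X]s_i size_takel //.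
  by rewrite -ltnS.
apply: big1 => i _; rewrite term0 //; apply: contraFN no => /and3P[-> -> /eqP s_i] /=.
by rewrite prefixE -[in X in take X]s_i -[in X in _ == X]s_i size_take_min take_min take_size.
Qed.

Lemma pelt_mul x s y t :
  pelt K (x, s) * pelt K (y, t) =
  if walk_end x s == y then pelt K (x, s ++ t) else 0.
Proof.
apply: path_algebraP => z u; rewrite coef_pelt_mul coef_pelt xpair_eqE.
have [end_s|end_s] := eqVneq (walk_end x s) y; last by rewrite andbF; case: ifP.
rewrite coef_pelt xpair_eqE; case: eqVneq => [->|_] /=; last by rewrite andbF.
have [/prefixP[v ->]|no] := boolP (prefix s u).
  by rewrite drop_size_cat // eqseq_cat // eqxx is_walk_cat end_s; case: is_walk.
rewrite andbF; case: eqVneq no => [->|_]; last by rewrite andbF.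
by rewrite prefix_prefix.
Qed.

(** Every path in the support of a multiple of the path [s] contains [s]. *)
Lemma mul_pelt_coef_infix f x s g y t :
  (f * pelt K (x, s) * g) (y, t) != 0 -> infix s t.
Proof.
rewrite -mulrA coef_pmul; apply: contraNT => no; apply/eqP/big1 => i _.
rewrite coef_pelt_mul ifN ?mulr0 //; apply: contra no => /and3P[_ _ /prefixP[u t_i]].
by apply/infixP; exists (take i t), u; rewrite -t_i cat_take_drop.
Qed.

(** The only factorization of [s] through [s] itself has trivial outer factors. *)
Lemma mul_pelt_coef_self f x s g :
  is_walk x s ->
  (f * pelt K (x, s) * g) (x, s) = f (x, [::]) * g (walk_end x s, [::]).
Proof.
move=> s_walk; rewrite -mulrA coef_pmul big_ord_recl big1 ?addr0 => [|i _].
  by rewrite take0 drop0 coef_pelt_mul eqxx s_walk prefix_refl drop_size.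
rewrite coef_pelt_mul ifN ?mulr0 //; apply/and3P => -[_ _ /size_prefix].
by rewrite size_drop leqNgt ltn_subrL (leq_ltn_trans (leq0n i) (ltn_ord i)).
Qed.

Lemma pelt_nwalk x s : ~~ is_walk x s -> pelt K (x, s) = 0.
Proof.
move=> no; apply: path_algebraP => y t; rewrite coef_pelt; case: eqP => [[-> ->]|_].
  by rewrite (negPf no).
by rewrite andbF.
Qed.

Lemma pelt_span f : exists s : seq (prepath Q), f = \sum_(p <- s) (f p : K) *: pelt K p.
Proof.
have /asboolP[f_walk [s f_s]] := pcoefP f; exists (undup s).
have coef_sum (r : seq (prepath Q)) q :
    (\sum_(p <- r) (f p : K) *: pelt K p) q = \sum_(p <- r) f p * pelt K p q.
  elim: r => [|p r IH]; first by rewrite !big_nil.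
  by rewrite !big_cons pcoefD pcoefZ IH.
apply: path_algebraP => x t; rewrite coef_sum.
have [ft0|ft] := eqVneq (f (x, t)) 0.
  rewrite big1 // => -[y u] _; rewrite coef_pelt.
  by case: eqP => [[<- <-]|_]; rewrite ?ft0 ?mul0r // andbF mulr0.
rewrite (bigD1_seq (x, t)) ?undup_uniq ?mem_undup ?f_s //= coef_pelt eqxx.
have -> : is_walk x t := f_walk _ ft.
rewrite mulr1 big1 ?addr0 // => -[y u] ne; rewrite coef_pelt eq_sym (negPf ne).
by rewrite andbF mulr0.
Qed.

(** [K] acts through the central elements [c *: 1], so ideals are subspaces. *)
Lemma in_idealZ (S : KQ -> Prop) (c : K) f : in_ideal S f -> in_ideal S (c *: f).
Proof. by move=> Sf; rewrite -[f]mul1r pscaleAl; apply: in_idealMl. Qed.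

End Paths.

Lemma qproj_eq0 (R : pzRingType) (S : R -> Prop) r : qproj S r = 0 <-> in_ideal S r.
Proof.
have S0 : qproj S 0 = 0 by apply: (addrI (qproj S 0)); rewrite -qprojD !addr0.
by rewrite -S0 qprojP subr0.
Qed.

(** * The cyclic orderings of the edges at the vertices of the tree *)

Section HalfEdges.
Variable G : brauer_tree.
Local Notation arrow := (half_edge G).
Local Notation next := (@Defs.next_at G).
Implicit Types (a b c : arrow).

Lemma hvert_next a : hvert (next a) = hvert a.
Proof. by apply/esym/eqP; rewrite -next_atP fconnect1. Qed.

Lemma half_edge_eq a b : hvert a = hvert b -> hedge a = hedge b -> a = b.
Proof.
rewrite /hvert /hedge => va ea; apply: val_inj.
by rewrite [val a]surjective_pairing va ea -surjective_pairing.
Qed.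

(** The map [next] is onto, because [b] is reached from [next b] around the same
    vertex; a surjection of a finite type onto itself is injective. *)
Lemma next_inj : injective next.
Proof.
pose prev b := iter (findex next (next b) b) next b.
have prevK : cancel prev next.
  move=> b; rewrite /prev -iterS iterSr iter_findex // next_atP.
  by rewrite hvert_next.
exact: bij_inj (bij_can_bij (injF_bij (can_inj prevK)) prevK).
Qed.

Lemma mem_orbit_next a b : (b \in orbit next a) = (hvert a == hvert b).
Proof. by rewrite -fconnect_orbit next_atP. Qed.

Lemma next_steps a b : hvert a = hvert b ->
  exists2 k, (k < order next a)%N & b = iter k next a.
Proof.
move=> ab; have a_b : fconnect next a b by rewrite next_atP ab.
by exists (findex next a b); rewrite ?findex_max ?iter_findex.
Qed.

Lemma order_next a b : hvert a = hvert b -> order next a = order next b.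
Proof. by move=> ab; apply: eq_card => c; rewrite !inE !next_atP ab. Qed.

Lemma sorted_next_hvert (s : seq arrow) a b :
  sorted (fun c d => d == next c) s -> a \in s -> b \in s -> hvert a = hvert b.
Proof.
case: s => // c s c_s.
have all_c : {in c :: s, forall d, hvert d = hvert c}.
  elim: s c c_s {a b} => [c _ d|d s IH c /= /andP[/eqP d_c s_d] b].
    by rewrite inE => /eqP->.
  by rewrite inE => /predU1P[->//|/IH->]; rewrite // d_c hvert_next.
by move=> /all_c-> /all_c->.
Qed.

Section Families.
Variable fam : arrow -> bool.
Hypothesis fam_ok : two_families fam.

(** The cycles at the two ends of an edge meet, so both families at one end
    differ from the family at the other end. *)
Lemma fam_hvert a b : hvert a = hvert b -> fam a = fam b.
Proof.
move=> ab.
have [w w_a w_ne] : exists2 w, w \in ends (hedge a) & w != hvert a.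
  have /eqP/cards2P[u [v [uv ->]]] := ends_card (hedge a).
  by case: (eqVneq u (hvert a)) uv => [<- uv|ne _]; [exists v|exists u];
    rewrite // ?inE ?eqxx ?orbT // eq_sym.
pose c : arrow := exist _ (w, hedge a) w_a.
have ac : fam a != fam c.
  by apply: fam_ok => [va|]; [rewrite va eqxx in w_ne|exists a, c].
have bc : fam b != fam c.
  apply: fam_ok => [vb|]; first by rewrite ab vb eqxx in w_ne.
  by exists a, c.
by case: (fam a) (fam b) (fam c) ac bc => [] [] [].
Qed.

(** Distinct half-edges of one edge sit at different ends of it, and the cycles
    of these two ends meet at that edge. *)
Lemma fam_hedge a b : hedge a = hedge b -> a != b -> fam a != fam b.
Proof.
move=> ab ne; apply: fam_ok => [va|].
  by case/eqP: ne; apply: half_edge_eq.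
by exists a, b.
Qed.
End Families.

End HalfEdges.

(** * Nonzero paths in the Brauer tree algebra *)

Section Algebra.
Variables (K : fieldType) (G : brauer_tree) (fam : half_edge G -> bool).
Hypothesis fam_ok : two_families fam.
Local Notation Q := (brauer_quiver G).
Local Notation KQ := (path_algebra K Q).
Local Notation arrow := (half_edge G).
Local Notation next := (@Defs.next_at G).
Local Notation rel := (@brauer_relation K G fam).
Local Notation A := (brauer_algebra K fam).
Implicit Types (a b c : arrow) (x y : tedge G) (f g h : KQ).

(** The path that starts with [a] and makes [k] steps around its vertex. *)
Definition arc a k : KQ := pelt K (hedge a : qvert Q, traject next a k).

Lemma walk_end_arc a k :
  walk_end (hedge a : qvert Q) (traject next a k) = hedge (iter k next a).
Proof.
elim: k a => //= k IH a; rewrite -iterS iterSr -IH.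
by case: k {IH}.
Qed.

Lemma is_walk_arc a k : is_walk (hedge a : qvert Q) (traject next a k).
Proof. by elim: k a => //= k IH a; rewrite eqxx IH. Qed.

Lemma arc_mul a k m : arc a k * arc (iter k next a) m = arc a (k + m).
Proof. by rewrite /arc pelt_mul walk_end_arc eqxx trajectD. Qed.

Lemma arr_mul a b :
  arr K a * arr K b =
  if hedge (next a) == hedge b then pelt K (hedge a : qvert Q, [:: a; b]) else 0.
Proof. by rewrite /arr /parrow pelt_mul. Qed.

Lemma cycle_power_arc a : cycle_power K a = arc a (order next a).
Proof.
rewrite /cycle_power /orbit; have := order_gt0 next a.
case: order => // k _; elim: k a => [|k IH] a; first by rewrite big_seq1.
by rewrite trajectS big_cons IH; apply: (arc_mul a 1).
Qed.

(** A lift to [K Q] of the symmetrizing form of the Brauer tree algebra, which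
    takes the value 1 on the socle generator of each [A e_x] and 0 on all other
    nonzero paths: an edge [x] has two half-edges [c], and hence two full turns,
    but these are identified in the algebra. *)
Definition trace_form f : K := \sum_(c : arrow) f (hedge c : qvert Q, orbit next c).

(** If the full turn from [a] is a subword of the full turn from [c], then both
    are around the same vertex, hence of the same length, and [a = c]. *)
Lemma trace_form_cycle f g a :
  trace_form (f * arc a (order next a) * g) =
  f (hedge a : qvert Q, [::]) * g (hedge a : qvert Q, [::]).
Proof.
rewrite /trace_form (bigD1 a) //= big1 ?addr0 => [|c c_a].
  rewrite mul_pelt_coef_self ?is_walk_arc // walk_end_arc iter_order //.
  exact: next_inj.
apply: contra_neqP (c_a) => /eqP/mul_pelt_coef_infix a_c.
have ac : hvert a = hvert c.
  by apply/eqP; rewrite eq_sym -mem_orbit_next (mem_infix a_c) // in_orbit.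
have : traject next a (order next a) == traject next c (order next c).
  by rewrite -(size_subseq_leqif (infixW a_c)) !size_traject (order_next ac).
by rewrite -(orderSpred _ a) -(orderSpred _ c) => /eqP[->].
Qed.

Lemma trace_formD f g : trace_form (f + g) = trace_form f + trace_form g.
Proof. exact: big_split. Qed.

Lemma trace_formB f g : trace_form (f - g) = trace_form f - trace_form g.
Proof. by rewrite /trace_form -sumrB. Qed.

(** The outer factors [f] and [g] make the induction over the two-sided ideal
    work. A mixed product contributes to no full turn, and the two full turns
    from an edge have the same trace by [trace_form_cycle], which depends on
    [a] only through [hedge a]. *)
Lemma trace_form_ideal r f g : in_ideal rel r -> trace_form (f * r * g) = 0.
Proof.
move=> rI; elim: rI f g => {r} [r|f g|r s _ IHr _ IHs f g|b r _ IH f g|b r _ IH f g].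
- case=> [a b ab|a b ab _ _] f g.
    apply: big1 => c _; apply: contra_neqP (ab) => /eqP.
    rewrite arr_mul; case: ifP => _; last by rewrite mulr0 mul0r eqxx.
    move/mul_pelt_coef_infix/mem_infix => ab_c.
    have /[!mem_orbit_next]/eqP ca := ab_c a (mem_head _ _).
    have /[!mem_orbit_next]/eqP cb : b \in orbit next c by rewrite ab_c ?inE ?eqxx ?orbT.
    by rewrite (fam_hvert fam_ok (a := a) (b := b)) ?eqxx // -ca.
  rewrite mulrBr mulrBl trace_formB !cycle_power_arc !trace_form_cycle ab.
  exact: subrr.
- by rewrite mulr0 mul0r; apply: big1.
- by rewrite mulrDr mulrDl trace_formD IHr IHs addr0.
- by rewrite mulrA IH.
- by rewrite mulrA -mulrA IH.
Qed.

(** The arc extends to the full turn from [a], whose trace is 1. *)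
Lemma arc_neq0 a k : (k <= order next a)%N -> ~ in_ideal rel (arc a k).
Proof.
move=> k_le /(trace_form_ideal 1 (arc (iter k next a) (order next a - k))).
rewrite mul1r arc_mul subnKC // -[arc a _]mul1r -[1 * _]mulr1 trace_form_cycle.
by rewrite mulr1 => /eqP; rewrite oner_eq0.
Qed.

(** If [a] and [b] are composable but [b] is not [next a], then [b] and [next a]
    are the two half-edges of one edge, so [a] and [b] are in different
    families. *)
Lemma arr_mul_ideal a b : b != next a -> in_ideal rel (arr K a * arr K b).
Proof.
move=> b_a; rewrite arr_mul; case: eqP => [ab|_]; last exact: in_ideal0.
have := arr_mul a b; rewrite ab eqxx => <-; apply: in_ideal_gen.
constructor; rewrite -(fam_hvert fam_ok (hvert_next a)).
by apply: fam_hedge; rewrite // eq_sym.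
Qed.

(** A path that does not turn around a single vertex contains a mixed pair. *)
Lemma path_ideal a (s : seq arrow) :
  is_walk (hedge a : qvert Q) (a :: s) ->
  ~~ path (fun b c => c == next b) a s ->
  in_ideal rel (pelt K (hedge a : qvert Q, a :: s)).
Proof.
elim: s a => //= b s IH a /and3P[_ /eqP ab s_walk] no.
have -> : pelt K (hedge a : qvert Q, [:: a, b & s]) =
          arr K a * pelt K (hedge b : qvert Q, b :: s).
  by rewrite /arr /parrow pelt_mul /walk_end /= ab eqxx.
have [ba|ba] := eqVneq b (next a); last first.
  have -> : pelt K (hedge b : qvert Q, b :: s) =
            arr K b * pelt K (hedge (next b) : qvert Q, s).
    by rewrite /arr /parrow pelt_mul /walk_end /= eqxx.
  by rewrite mulrA; apply/in_idealMr/arr_mul_ideal.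
apply/in_idealMl/IH; first by rewrite /= eqxx.
by move: no; rewrite ba eqxx.
Qed.

Lemma qproj_mul f g : (qproj rel (f * g) : A) = (qproj rel f : A) * (qproj rel g : A).
Proof. exact: qprojM. Qed.

(** The corner [e_x K Q e_y] is spanned by the paths from [x] to [y]. One that is
    outside the ideal turns around a vertex, which is common to [x] and [y]; the
    trivial path is the case [x = y], where either end of [x] is common. *)
Lemma corner_ideal x y r :
  (forall a b, hedge a = x -> hedge b = y -> hvert a <> hvert b) ->
  in_ideal rel (pidem K (x : qvert Q) * r * pidem K (y : qvert Q)).
Proof.
move=> apart; have [s ->] := pelt_span r.
elim: s => [|[z t] s IH]; first by rewrite big_nil mulr0 mul0r; apply: in_ideal0.
rewrite big_cons mulrDr mulrDl; apply: in_idealD => //; move: (r _) => {IH} c.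
rewrite -pscaleAr -pscaleAl; apply: in_idealZ.
rewrite /pidem pelt_mul; case: ifP => [_|_]; last by rewrite mul0r; apply: in_ideal0.
rewrite pelt_mul cats0; case: eqP => [end_t|_]; last exact: in_ideal0.
have [t_walk|no] := boolP (is_walk (x : qvert Q) t); last first.
  by rewrite pelt_nwalk //; apply: in_ideal0.
case: t => [|a t] in end_t t_walk *.
  have /eqP/cards2P[v [w [_ vw]]] := ends_card x.
  have v_x : v \in ends x by rewrite vw finset.set21.
  pose a : arrow := exist _ (v, x) v_x.
  by case: (apart a a).
have /andP[/eqP ax _] := t_walk; rewrite -ax; apply: path_ideal.
  by rewrite -ax in t_walk.
apply/negP => a_t; pose b := last a t.
apply: (apart a (next b)) => //.
  by rewrite -end_t; apply: esym (last_map (@qtgt Q) t a).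
rewrite hvert_next; apply: (@sorted_next_hvert G (a :: t)); rewrite ?mem_head //.
exact: mem_last.
Qed.

(** Around a common vertex of [x] and [y] there is an arc from [x] to [y], which
    is nonzero in the algebra; the converse is [corner_ideal]. *)
Lemma corner_neq0 x y :
  (exists u : A, idem K fam x * u * idem K fam y <> 0) <->
  (exists a b, [/\ hedge a = x, hedge b = y & hvert a = hvert b]).
Proof.
split=> [[u]|[a [b [<- <- ab]]]].
  apply: contra_notP => no; rewrite -(qprojK u) /idem -!qproj_mul qproj_eq0.
  by apply: corner_ideal => a b ax bY ab; apply: no; exists a, b.
have [k k_lt ->] := next_steps ab.
exists (qproj rel (arc a k)); rewrite /idem -!qproj_mul qproj_eq0.
rewrite /pidem pelt_mul eqxx pelt_mul walk_end_arc eqxx cats0.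
exact: arc_neq0 (ltnW k_lt).
Qed.

Lemma arrA_mul_neq0 a b : arrA K fam a * arrA K fam b != 0 -> b = next a.
Proof.
move=> ab; apply/eqP; apply: contraNT ab => /arr_mul_ideal ab.
by apply/eqP; rewrite /arrA -qproj_mul qproj_eq0.
Qed.

(** Two steps make at most one full turn, unless [a] is a loop. *)
Lemma arrA_mul_next a : (1 < order next a)%N ->
  arrA K fam a * arrA K fam (next a) != 0.
Proof.
move=> a_lt; apply/eqP; rewrite /arrA -qproj_mul qproj_eq0 arr_mul eqxx.
exact: (@arc_neq0 a 2).
Qed.

Lemma A_chain_hvert (s : seq arrow) a b :
  A_chain K fam s -> a \in s -> b \in s -> hvert a = hvert b.
Proof.
case=> _ s_chain; apply: sorted_next_hvert.
by apply: sub_sorted s_chain => c d /arrA_mul_neq0->.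
Qed.

(** Arrows of one chain are around one vertex and do not repeat, so no chain is
    longer than the orbit. An orbit with a single arrow [a] is a loop, and is a
    chain although [a * a] is zero, since it has no two consecutive entries. *)
Lemma orbit_A_cycle a : A_cycle K fam (orbit next a).
Proof.
have chain : A_chain K fam (orbit next a).
  split; first exact: orbit_uniq.
  have [le1|gt1] := leqP (order next a) 1.
    rewrite /orbit; case: (order next a) le1 => [|[]] //.
  rewrite /orbit -orderSpred /=.
  apply: (sub_in_path (P := [pred c | hvert c == hvert a])) (fpath_traject _ _ _).
    move=> c d /eqP ca _ /eqP <-; apply: arrA_mul_next.
    by rewrite (order_next ca).
  apply/allP => c; rewrite -trajectS orderSpred -/(orbit _ _) mem_orbit_next.
  by rewrite /= eq_sym.
split=> // t t_chain s_t; apply/esym/eqP.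
rewrite -(size_subseq_leqif (infixW s_t)) eqn_leq size_subseq ?infixW //=.
apply: uniq_leq_size => [|b b_t]; first by case: t_chain.
rewrite mem_orbit_next; apply/eqP/(A_chain_hvert t_chain) => //.
by rewrite (mem_infix s_t) // in_orbit.
Qed.

Lemma common_A_cycle x y :
  (exists s, [/\ A_cycle K fam s, lies_on x s & lies_on y s]) <->
  (exists a b, [/\ hedge a = x, hedge b = y & hvert a = hvert b]).
Proof.
split=> [[s [[s_chain _] s_x s_y]]|[a [b [<- <- ab]]]].
  have on z : lies_on z s -> exists c d, [/\ c \in s, hedge d = z & hvert d = hvert c].
    by case=> c c_s [->|->]; [exists c, c|exists c, (next c); rewrite hvert_next].
  have [c [a [c_s ax ac]]] := on x s_x; have [d [b [d_s bY bd]]] := on y s_y.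
  by exists a, b; rewrite ac bd (A_chain_hvert s_chain c_s d_s).
exists (orbit next a); split; first exact: orbit_A_cycle.
  by exists a; [exact: in_orbit|left].
by exists b; [rewrite mem_orbit_next ab|left].
Qed.

End Algebra.

(** * Morphisms of stalk complexes and of principal left ideals *)

Section Morphisms.
Variable R : pzRingType.
Implicit Types M N : lmodType R.

Definition has_nonzero_map M N : Prop :=
  exists f : {linear M -> N}, exists z, f z <> 0.

(** Terms of stalk complexes are conditionals on a comparison of degrees, which
    reduce only once these booleans are replaced by variables. *)
Definition stalk_map (b1 b2 : bool) M N (f : {linear M -> N}) :
  {linear (if b1 then M else 'rV[R]_0) -> (if b2 then N else 'rV[R]_0)} :=
  match b1, b2 with
  | true, true => f
  | _, _ => \0
  end.

Lemma stalk_map_neq0 M N (b1 b2 : bool)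
    (f : {linear (if b1 then M else 'rV[R]_0) -> (if b2 then N else 'rV[R]_0)}) z :
  f z <> 0 -> [/\ b1, b2 & has_nonzero_map M N].
Proof.
case: b1 b2 f z => [] [] f z fz; first by split=> //; exists f, z.
- by case: fz; apply: etrans (thinmx0 _) (esym (thinmx0 _)).
- by case: fz; rewrite [z]thinmx0 linear0.
- by case: fz; rewrite [z]thinmx0 linear0.
Qed.

Lemma stalk_map_eq0 M N (b1 b2 : bool) (f : {linear M -> N}) :
  b1 -> b2 -> (forall z, stalk_map b1 b2 f z = 0) -> forall z, f z = 0.
Proof. by case: b1; case: b2. Qed.

(** The differentials are zero, so homotopic chain maps are equal; a component
    can be nonzero only in a degree where neither complex vanishes. *)
Lemma HomK_stalk_neq0 M N (a b : int) :
  HomK_neq0 (stalk a M) (stalk b N) <-> a = b /\ has_nonzero_map M N.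
Proof.
split=> [[f nf]|[<- [f [z fz]]]].
  have [i [z fz]] : exists i z, f i z <> 0.
    apply: contra_notP nf => f0; exists (fun i j => \0) => i z /=.
    rewrite subr0 addr0; apply: contra_notP f0; by exists i, z.
  have [/eqP <- /eqP <- //] := stalk_map_neq0 fz.
have fC i j x : stalk_map (j == a) (j == a) f (cdiff (stalk a M) i j x) =
    cdiff (stalk a N) i j (stalk_map (i == a) (i == a) f x).
  by rewrite /= linear0.
exists (@ChainMap R (stalk a M) (stalk a N) _ fC).
case=> h h0; apply: fz; apply: (stalk_map_eq0 (eqxx a) (eqxx a)) => u.
by have /= := h0 a u; rewrite subr0 linear0 addr0.
Qed.

(** The element [p] is the preimage of [e] itself. *)
Lemma iso_left_ideal_gen M (e : R) : e * e = e -> module_iso M (left_ideal e) ->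
  exists p : M, e *: p = p /\ forall z, exists r, z = r *: p.
Proof.
move=> ee [f [f' fK f'K]].
have e_in : e \in principal_left e by apply/asboolP; exists 1; rewrite mul1r.
exists (f' (LeftIdeal e_in)); split=> [|z].
  by apply: (can_inj fK); rewrite linearZ f'K; apply: val_inj; rewrite /= /GRing.scale /=.
have /asboolP[r fz] := left_idealP (f z).
exists r; apply: (can_inj fK); rewrite linearZ f'K; apply: val_inj.
exact: fz.
Qed.

Section RightMultiplication.
Variables e e' u : R.

Lemma rmul_subproof (z : left_ideal e)  :
  (left_ideal_val z : R) * u * e' \in principal_left e'.
Proof. by apply/asboolP; exists ((left_ideal_val z : R) * u). Qed.

Definition rmul_map z : left_ideal e' := LeftIdeal (rmul_subproof z).

Lemma rmul_map_linear : linear rmul_map.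
Proof. by move=> c z t; apply: val_inj; rewrite /= !mulrDl -!mulrA. Qed.
HB.instance Definition _ :=
  GRing.isLinear.Build R (left_ideal e) (left_ideal e') _ rmul_map rmul_map_linear.
End RightMultiplication.

(** This is [Hom (R e, R e') = e R e']: a map [f] corresponds to [f e], which lies
    in [R e'] and is fixed by [e], and [e * u * e'] to the right multiplication
    by [u * e']. *)
Lemma nonzero_map_iso M N (e e' : R) : e * e = e -> e' * e' = e' ->
  module_iso M (left_ideal e) -> module_iso N (left_ideal e') ->
  has_nonzero_map M N <-> exists u, e * u * e' <> 0.
Proof.
move=> ee ee' isoM [g g_bij]; have [g' gK g'K] := g_bij.
split=> [[f [z fz]]|[u eue']].
  have [p [ep gen_p]] := iso_left_ideal_gen ee isoM.
  have /asboolP[u gfp] := left_idealP (g (f p)).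
  exists u => eue'; apply: fz; have [r ->] := gen_p z.
  rewrite linearZ_LR -ep linearZ_LR; suff -> : e *: f p = 0 by rewrite scaler0.
  apply: (can_inj gK); rewrite linearZ linear0; apply: val_inj => /=.
  by rewrite gfp -eue' -mulrA.
case: isoM => f [f' fK f'K].
pose g'L := GRing.isLinear.Build R _ _ _ g' (can2_linear gK g'K).
pose g'l : {linear left_ideal e' -> N} := HB.pack g' g'L.
exists (g'l \o (@rmul_map e e' u \o f)).
have e_in : e \in principal_left e by apply/asboolP; exists 1; rewrite mul1r.
exists (f' (LeftIdeal e_in)) => /= /(congr1 g); rewrite f'K g'K linear0.
by move/(congr1 (@left_ideal_val R e')).
Qed.

End Morphisms.

Theorem proposition4
  (K : closedFieldType) (G : brauer_tree)
  (fam : half_edge G -> bool) (fam_ok : two_families fam)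
  (Pi Pj : lmodType (brauer_algebra K fam)) (x y : tedge G) (a b : int)
  (Pi_fg : fin_gen Pi) (Pi_proj : projective Pi) (Pi_ind : indecomposable Pi)
  (Pj_fg : fin_gen Pj) (Pj_proj : projective Pj) (Pj_ind : indecomposable Pj)
  (Pi_x : module_iso Pi (proj_at K fam x))
  (Pj_y : module_iso Pj (proj_at K fam y))
  (a01 : a = 0 \/ a = 1) (b01 : b = 0 \/ b = 1)
  (pt : partial_tilting (dsum (stalk a Pi) (stalk b Pj))) :
  HomK_neq0 (stalk a Pi) (stalk b Pj) <->
  (a = b /\ exists s : seq (half_edge G),
              [/\ A_cycle K fam s, lies_on x s & lies_on y s]).
Proof.
have idemK z : idem K fam z * idem K fam z = idem K fam z.
  by rewrite /idem -qproj_mul /pidem pelt_mul eqxx.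
rewrite HomK_stalk_neq0 (nonzero_map_iso (idemK x) (idemK y) Pi_x Pj_y).
by rewrite corner_neq0 // common_A_cycle.
Qed.
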